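(* Let the random measure $\xi$ on $\mathbb R^d$ have a density field $Z=(Z_s)_{s\in\mathbb R^d}$ which is strictly positive everywhere. If $((X,Z),\xi)$ is mass-stationary under a measure $\mathbf P^\circ$, then $(X,Z)$ is stationary under the measure $\mathbf P$ defined by $$d\mathbf P=\frac1{Z_0}\,d\mathbf P^\circ,$$ and $((X,Z),\xi)$ under $\mathbf P^\circ$ is the Palm version of $((X,Z),\xi)$ under $\mathbf P$.
   Context: Setting. $(\Omega,\mathcal F)$ is a measurable space carrying the random elements (extended if further randomization is needed); $\mathbf P$ and $\mathbf P^\circ$ are measures on it, not necessarily probability measures, with integrals $\mathbf E$, $\mathbf E^\circ$. $\lambda$ is Lebesgue measure on $\mathbb R^d$. For a measure $\mu$ and a set $A$ with $0<\mu(A)<\infty$, $\mu(\cdot\mid A):=\mu(\cdot\cap A)/\mu(A)$. The symbol $\overset{D}{=}$ denotes equality of distributions (under the indicated measure). A random element $W$ in a measurable space $(G,\mathcal G)$ on which the additive group $\mathbb R^d$ acts by maps $\theta_t$ is called shift-measurable if $(t,w)\mapsto\theta_tw$ is measurable from $\mathbb R^d\times G$ to $G$. $X$ is a shift-measurable random element in a space $(E,\mathcal E)$. For a random field $Z=(Z_s)_{s\in\mathbb R^d}$, regarded as a random element of a shift-invariant path space with the $\sigma$-algebra generated by the evaluations, $\theta_tZ:=(Z_{t+s})_{s\in\mathbb R^d}$. For a measure, $\theta_t\xi(B):=\xi(B+t)$ for Borel $B\subseteq\mathbb R^d$. Shifts act componentwise: $\theta_t(X,Z)=(\theta_tX,\theta_tZ)$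 and $\theta_t((X,Z),\xi)=(\theta_t(X,Z),\theta_t\xi)$. Random measures are locally finite. The distributions of $((X,Z),\xi)$ under $\mathbf P$ and $\mathbf P^\circ$ are understood to be $\sigma$-finite. Density field: $\xi$ has density field $Z$ if $Z=(Z_s)_{s\in\mathbb R^d}$ is a shift-measurable random field with values in $[0,\infty)$ and $\xi(ds)=Z_s\,ds$. Stationarity: $(X,Z)$ is stationary under $\mathbf P$ if $\theta_t(X,Z)\overset{D}{=}(X,Z)$ under $\mathbf P$ for all $t\in\mathbb R^d$ (and similarly for $((X,Z),\xi)$). Mass-stationarity: for a shift-measurable random element $W$ and a random measure $\xi$ having $0$ in its support $\mathbf P^\circ$-a.e., $(W,\xi)$ is mass-stationary under $\mathbf P^\circ$ if for all bounded Borel $C\subset\mathbb R^d$ with $\lambda(C)>0$ and $\lambda(\partial C)=0$, $$(\theta_{V_C}(W,\xi),V_C+U_C)\overset{D}{=}((W,\xi),U_C)\quad\text{under }\mathbf P^\circ,$$ where under $\mathbf P^\circ$ the conditional distribution of $U_C$ given $(W,\xi)$ is uniform on $C$ and the conditional distribution of $V_C$ given $((W,\xi),U_C)$ is $\xi(\cdot\mid C-U_C)$, with $C-x:=\{y-x:y\in C\}$. Here $W=(X,Z)$. Palm version: $(W,\xi)$ under $\mathbf P^\circ$ is the Palm version of a stationary pair $(W,\xi)$ under $\mathbf P$ if for each nonnegative measurable $f$ and some (equivalently each) Borel $B\subset\mathbb R^d$ with $0<\lambda(B)<\infty$, $$\mathbf E^\circ[f(W,\xi)]=\mathbf E\Big[\int_B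 f(\theta_t(W,\xi))\,\xi(dt)\Big]\Big/\lambda(B).$$ *)

(* Defs.v *)
From HB Require Import structures.
From mathcomp Require Import all_boot all_order all_algebra.
From mathcomp Require Import all_classical all_reals all_analysis measurable_realfun.
Import numFieldNormedType.Exports.
Import Order.TTheory GRing.Theory Num.Theory.

Set Implicit Arguments.
Unset Strict Implicit.
Unset Printing Implicit Defensive.

Local Open Scope classical_set_scope.
Local Open Scope ring_scope.

Section borel_rV.
Context {R : realType} {d : nat}.

Definition rV_display : measure_display. Proof. by constructor. Qed.

Definition borel_rV : set (set 'rV[R]_d) := <<s [set U : set 'rV[R]_d | open U] >>.

Let borel_rV0 : borel_rV set0. Proof. exact: sigma_algebra0. Qed.

Let borel_rVC A : borel_rV A -> borel_rV (~` A).
Proof. exact: sigma_algebraC. Qed.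

Let borel_rVU (F : (set 'rV[R]_d)^nat) :
  (forall i, borel_rV (F i)) -> borel_rV (\bigcup_i F i).
Proof. exact: sigma_algebra_bigcup. Qed.

HB.instance Definition _ := @isMeasurable.Build rV_display 'rV[R]_d borel_rV
  borel_rV0 borel_rVC borel_rVU.

Lemma open_measurable_rV (U : set 'rV[R]_d) : open U -> measurable U.
Proof. exact: sub_sigma_algebra. Qed.

Lemma measurable_coord (j : 'I_d) :
  measurable_fun [set: 'rV[R]_d] (fun x : 'rV[R]_d => x ord0 j).
Proof.
apply: (measurability _ (RGenOInfty.measurableE R)).
move=> _ [_ [x ->] <-]; rewrite setTI; apply: open_measurable_rV.
by apply: open_comp; [move=> y _; exact: coord_continuous|exact: interval_open].
Qed.

Lemma open_rV_bigcup (U : set 'rV[R]_d) : open U ->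
  U = \bigcup_(k in [set k : 'rV[rat]_d * nat |
        [set x : 'rV[R]_d | forall j, `|x ord0 j - ratr (k.1 ord0 j)| < k.2.+1%:R^-1]
        `<=` U])
      [set x : 'rV[R]_d | forall j, `|x ord0 j - ratr (k.1 ord0 j)| < k.2.+1%:R^-1].
Proof.
move=> oU; apply/seteqP; split; last by move=> x [k kU kx]; exact: kU.
move=> x Ux; have /nbhs_ballP[e /= e0 xeU] : nbhs x U by exact: open_nbhs_nbhs.
have [n ne] : exists n, 2 * n.+1%:R^-1 < e.
  exists (Num.truncn (2 / e)).
  rewrite ltr_pdivrMr ?ltr0n// -ltr_pdivrMl// mulrC.
  exact: truncnS_gt.
have /choice[q qP] : forall j, exists q : rat, `|x ord0 j - ratr q| < n.+1%:R^-1.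
  move=> j; have : x ord0 j - n.+1%:R^-1 < x ord0 j + n.+1%:R^-1.
    by rewrite ltrD2l gt0_cp// invr_gt0 ltr0n.
  move=> /rat_in_itvoo[q /itvP xq]; exists q.
  by rewrite distrC ltr_distl !xq.
exists (\row_j q j, n); last by move=> j /=; rewrite mxE.
move=> y /= yq; apply: xeU; split => // i j; rewrite (ord1 i).
rewrite /ball/= (le_lt_trans (ler_distD (ratr (q j)) _ _))//.
rewrite (lt_trans _ ne)// mulr_natl mulr2n ltrD//.
by rewrite distrC; have := yq j; rewrite mxE.
Qed.

Lemma measurable_fun_rV d' (T : measurableType d') (f : T -> 'rV[R]_d) :
  (forall j, measurable_fun [set: T] (fun x => f x ord0 j)) ->
  measurable_fun [set: T] f.
Proof.
move=> mf; apply: (@measurability _ _ _ _ _ f [set U : set 'rV[R]_d | open U]) => //.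
move=> _ [U oU <-]; rewrite setTI (open_rV_bigcup oU) preimage_bigcup bigcup_mkcond.
apply: countable_bigcupT_measurable; first exact: countableP.
move=> k; case: ifPn => // _.
rewrite (_ : _ @^-1` _ = \bigcap_(j in [set: 'I_d])
    ((fun x => f x ord0 j) @^-1` ball (ratr (k.1 ord0 j) : R) k.2.+1%:R^-1)).
  apply: fin_bigcap_measurable => // j _; rewrite -[X in measurable X]setTI.
  apply: mf => //; apply: open_measurable; exact: ball_open.
apply/seteqP; split => x /= + j; move=> /(_ j); rewrite /ball/= distrC//.
by move=> /(_ I); rewrite distrC.
Qed.

End borel_rV.

Section lebesgue_rV.
Context {R : realType}.

Definition cons_rV d (p : measurableTypeR R * 'rV[R]_d) : 'rV[R]_d.+1 :=
  \row_j oapp (p.2 ord0) p.1 (unlift ord0 j).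

Let uncons_rV d (x : 'rV[R]_d.+1) : measurableTypeR R * 'rV[R]_d :=
  (x ord0 ord0, \row_j x ord0 (lift ord0 j)).

Let cons_rVK d : cancel (@cons_rV d) (@uncons_rV d).
Proof.
move=> [a v]; congr (_, _) => /=; first by rewrite mxE unlift_none.
by apply/rowP => j; rewrite !mxE liftK.
Qed.

Lemma measurable_cons_rV d : measurable_fun [set: _] (@cons_rV d).
Proof.
apply: measurable_fun_rV => j; under eq_fun do rewrite mxE.
case: unliftP => [k|] _ /=; last exact: measurable_fst.
apply: (@measurableT_comp _ _ _ _ _ _ (fun x : 'rV[R]_d => x ord0 k)).
  exact: measurable_coord.
exact: measurable_snd.
Qed.

Let measurable_uncons_rV d : measurable_fun [set: _] (@uncons_rV d).
Proof.
apply/measurable_fun_pairP; split; first exact: measurable_coord.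
apply: measurable_fun_rV => j; rewrite [X in measurable_fun _ X](_ : _ =
    fun x : 'rV[R]_d.+1 => x ord0 (lift ord0 j)).
  exact: measurable_coord.
by apply/funext => x /=; rewrite mxE.
Qed.

Section step.
Variables (d : nat) (mu : {sigma_finite_measure set 'rV[R]_d -> \bar R}).
Local Open Scope ereal_scope.

Definition lebesgue_cons : set 'rV[R]_d.+1 -> \bar R :=
  pushforward (lebesgue_measure \x mu) (@cons_rV d).

Let lebesgue_cons0 : lebesgue_cons set0 = 0.
Proof. by rewrite /lebesgue_cons /pushforward preimage_set0; exact: measure0. Qed.

Let lebesgue_cons_ge0 A : 0 <= lebesgue_cons A.
Proof. by rewrite /lebesgue_cons /pushforward; exact: measure_ge0. Qed.

Let lebesgue_cons_sigma_additive : semi_sigma_additive lebesgue_cons.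
Proof.
move=> F mF tF mUF; rewrite /lebesgue_cons /pushforward preimage_bigcup.
have mcF n : measurable (@cons_rV d @^-1` F n).
  by rewrite -[X in measurable X]setTI; exact: measurable_cons_rV.
apply: measure_semi_sigma_additive => //; last exact: bigcup_measurable.
apply/trivIsetP => i j _ _ ij; rewrite -preimage_setI.
by move/trivIsetP : tF => ->//; rewrite preimage_set0.
Qed.

HB.instance Definition _ := isMeasure.Build _ _ _ lebesgue_cons
  lebesgue_cons0 lebesgue_cons_ge0 lebesgue_cons_sigma_additive.

Let lebesgue_cons_sigma_finite : sigma_finite [set: 'rV[R]_d.+1] lebesgue_cons.
Proof.
have /sigma_finiteP[F [FT ndF Ffin]] :
    sigma_finite setT (lebesgue_measure : set (measurableTypeR R) -> \bar R).
  exact: sigma_finiteT.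
have /sigma_finiteP[G [GT ndG Gfin]] := sigma_finiteT mu.
exists (fun n => (@uncons_rV d) @^-1` (F n `*` G n)).
  apply/esym; rewrite -subTset => x _.
  have [i _ Fi] : (\bigcup_i F i) (uncons_rV x).1 by rewrite -FT.
  have [j _ Gj] : (\bigcup_i G i) (uncons_rV x).2 by rewrite -GT.
  exists (maxn i j) => //; split.
    by move: Fi; exact/subsetPset/ndF/leq_maxl.
  by move: Gj; exact/subsetPset/ndG/leq_maxr.
move=> n; have [mF Foo] := Ffin n; have [mG Goo] := Gfin n; split.
  rewrite -[X in measurable X]setTI; apply: measurable_uncons_rV => //.
  exact: measurableX.
rewrite /lebesgue_cons /pushforward -comp_preimage.
rewrite (_ : _ \o _ = id) ?preimage_id; last by apply/funext => p; exact: cons_rVK.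
by rewrite product_measure1E// lte_mul_pinfty// ge0_fin_numE.
Qed.

HB.instance Definition _ := Measure_isSigmaFinite.Build _ _ _ lebesgue_cons
  lebesgue_cons_sigma_finite.

End step.

(* The product of d copies of the Lebesgue measure of R, coordinate 0 being
   split off first; lebesgue_rV_box below computes it on half-open boxes, which
   determines it on all Borel sets. *)
Fixpoint lebesgue_rV d : {sigma_finite_measure set 'rV[R]_d -> \bar R} :=
  if d is d'.+1 then lebesgue_cons (lebesgue_rV d')
  else \d_(0 : 'rV[R]_0).

End lebesgue_rV.

Lemma lebesgue_rV_box (R : realType) d (a b : 'rV[R]_d) :
  (forall j, a ord0 j <= b ord0 j) ->
  lebesgue_rV d [set x : 'rV[R]_d | forall j, a ord0 j < x ord0 j <= b ord0 j] =
  (\prod_j (b ord0 j - a ord0 j))%:E.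
Proof.
elim: d a b => [|d IH] a b ab.
  by rewrite big_ord0 /= diracE mem_set// => -[].
pose t (c : 'rV[R]_d.+1) : 'rV[R]_d := \row_j c ord0 (lift ord0 j).
rewrite big_ord_recl [LHS]/= /lebesgue_cons /pushforward.
transitivity ((lebesgue_measure \x lebesgue_rV d)%E
    ((`]a ord0 ord0, b ord0 ord0]%classic : set (measurableTypeR R)) `*`
     [set x : 'rV[R]_d | forall j, t a ord0 j < x ord0 j <= t b ord0 j])).
  congr (_ _); apply/seteqP; split => [[x v] /= xv|[x v] /= [+ xv] j].
    split; first by have := xv ord0; rewrite mxE unlift_none /= in_itv.
    by move=> j; have := xv (lift ord0 j); rewrite !mxE liftK.
  rewrite in_itv/= => xab; rewrite mxE.
  by case: unliftP => [k|] ->//=; have := xv k; rewrite !mxE.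
have mbox : measurable [set x : 'rV[R]_d | forall j, t a ord0 j < x ord0 j <= t b ord0 j].
  rewrite (_ : [set _ | _] = \bigcap_(j in [set: 'I_d])
      ((fun x : 'rV[R]_d => x ord0 j) @^-1` `]t a ord0 j, t b ord0 j]%classic)).
    apply: fin_bigcap_measurable => // j _; rewrite -[X in measurable X]setTI.
    exact: measurable_coord.
  apply/seteqP; split => x /= H j; first by move=> _; rewrite /= in_itv; exact: H.
  by have := H j I; rewrite /= in_itv.
rewrite product_measure1E// IH => [|j]; last by rewrite !mxE.
rewrite -[X in (X * _)%E]/(lebesgue_measure `]a ord0 ord0, b ord0 ord0]%classic).
rewrite lebesgue_measure_itv /= lte_fin; case: ltgtP (ab ord0) => // [_|->] _.
  by rewrite -EFinD -EFinM; congr (_ * _)%:E; apply: eq_bigr => j _; rewrite !mxE.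
by rewrite subrr mul0r mul0e.
Qed.

Section locally_finite_measure.
Context {R : realType} {d : nat}.
Local Open Scope ereal_scope.

(* A {measure set T -> \bar R} is a function on all subsets of T, so two
   elements of lfmeasure may agree on Borel sets without being equal; the
   sigma-algebra below, generated by the evaluations at Borel sets, does not
   separate them. *)
Record lfmeasure := LFMeasure {
  lfmeasure_val :> {measure set 'rV[R]_d -> \bar R} ;
  lfmeasure_lty : forall B : set 'rV[R]_d,
    measurable B -> bounded_set B -> lfmeasure_val B < +oo }.

HB.instance Definition _ := gen_eqMixin lfmeasure.
HB.instance Definition _ := gen_choiceMixin lfmeasure.

Let mzero_lty (B : set 'rV[R]_d) :
  measurable B -> bounded_set B -> @mzero _ 'rV[R]_d R B < +oo.
Proof. by move=> _ _; rewrite /mzero ltry. Qed.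

HB.instance Definition _ := isPointed.Build lfmeasure (LFMeasure mzero_lty).

Definition lfmeasure_display : measure_display. Proof. by constructor. Qed.

Definition lfmeasure_measurable : set (set lfmeasure) :=
  <<s \bigcup_(B in @measurable _ 'rV[R]_d)
        preimage_set_system setT (fun mu : lfmeasure => mu B) measurable >>.

Let lfmeasure_measurable0 : lfmeasure_measurable set0.
Proof. exact: sigma_algebra0. Qed.

Let lfmeasure_measurableC A :
  lfmeasure_measurable A -> lfmeasure_measurable (~` A).
Proof. exact: sigma_algebraC. Qed.

Let lfmeasure_measurableU (F : (set lfmeasure)^nat) :
  (forall i, lfmeasure_measurable (F i)) ->
  lfmeasure_measurable (\bigcup_i F i).
Proof. exact: sigma_algebra_bigcup. Qed.

HB.instance Definition _ := @isMeasurable.Build lfmeasure_display lfmeasure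
  lfmeasure_measurable lfmeasure_measurable0 lfmeasure_measurableC
  lfmeasure_measurableU.

Let translateE (t : 'rV[R]_d) (B : set 'rV[R]_d) :
  [set (x + t)%R | x in B] = (fun x => x - t)%R @^-1` B.
Proof.
apply/seteqP; split => [_ [x Bx <-]|x Bx] /=; first by rewrite addrK.
by exists (x - t)%R; rewrite ?subrK.
Qed.

Lemma measurable_translate (t : 'rV[R]_d) (B : set 'rV[R]_d) :
  measurable B -> measurable [set (x + t)%R | x in B].
Proof.
move=> mB; rewrite translateE -[X in measurable X]setTI.
suff : measurable_fun [set: 'rV[R]_d] (fun x : 'rV[R]_d => x - t)%R by exact.
apply: measurable_fun_rV => j.
rewrite [X in measurable_fun _ X](_ : _ =
  fun x : 'rV[R]_d => (x ord0 j - t ord0 j)%R); last first.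
  by apply/funext => x; rewrite !mxE.
by apply: measurable_funB => //; exact: measurable_coord.
Qed.

(* (theta_t mu)(B) = mu(B + t) *)
Section lfmeasure_shift.
Variables (t : 'rV[R]_d) (mu : lfmeasure).

Definition translate_measure (B : set 'rV[R]_d) : \bar R :=
  mu [set (x + t)%R | x in B].

Let translate_measure0 : translate_measure set0 = 0.
Proof. by rewrite /translate_measure image_set0 measure0. Qed.

Let translate_measure_ge0 B : 0 <= translate_measure B.
Proof. exact: measure_ge0. Qed.

Let translate_measure_sigma_additive : semi_sigma_additive translate_measure.
Proof.
move=> F mF tF mUF; rewrite /translate_measure image_bigcup.
apply: measure_semi_sigma_additive => [i||].
- exact: measurable_translate.
- apply/trivIsetP => i j _ _ ij; rewrite !translateE -preimage_setI.
  by move/trivIsetP : tF => ->//; rewrite preimage_set0.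
- by apply: bigcup_measurable => i _; exact: measurable_translate.
Qed.

HB.instance Definition _ := isMeasure.Build _ _ _ translate_measure
  translate_measure0 translate_measure_ge0 translate_measure_sigma_additive.

Let translate_measure_lty (B : set 'rV[R]_d) :
  measurable B -> bounded_set B -> translate_measure B < +oo.
Proof.
move=> mB [M [Mr MB]]; apply: lfmeasure_lty; first exact: measurable_translate.
exists (M + `|t|)%R; split; first by rewrite num_real.
move=> N MN _ [x Bx <-] /=.
rewrite (le_trans (ler_normD _ _))// -lerBrDr.
by apply: (MB (N - `|t|)%R); rewrite // ltrBrDr.
Qed.

Definition lfmeasure_shift : lfmeasure := LFMeasure translate_measure_lty.

End lfmeasure_shift.
End locally_finite_measure.
Arguments lfmeasure : clear implicits.

Section path_space.
Context {R : realType} {d : nat}.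

(* A shift-invariant space of [0, +oo[-valued functions on R^d; a random field
   with paths in it is a measurable map to path_of H, for the sigma-algebra
   generated by the evaluations z |-> z s. *)
Record pathSpace := PathSpace {
  paths : set ('rV[R]_d -> R) ;
  paths_nonempty : paths !=set0 ;
  paths_ge0 : forall z s, paths z -> 0 <= z s ;
  paths_shift : forall z t, paths z -> paths (fun s => z (t + s)) }.

Variable H : pathSpace.

Record path_of := PathOf {
  path_val :> 'rV[R]_d -> R ;
  path_valP : paths H path_val }.

HB.instance Definition _ := gen_eqMixin path_of.
HB.instance Definition _ := gen_choiceMixin path_of.
HB.instance Definition _ :=
  isPointed.Build path_of (PathOf (projT2 (cid (paths_nonempty H)))).

Definition path_display : measure_display. Proof. by constructor. Qed.

Definition path_measurable : set (set path_of) :=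
  <<s \bigcup_(s in [set: 'rV[R]_d])
        preimage_set_system setT (fun z : path_of => z s) measurable >>.

Let path_measurable0 : path_measurable set0.
Proof. exact: sigma_algebra0. Qed.

Let path_measurableC A : path_measurable A -> path_measurable (~` A).
Proof. exact: sigma_algebraC. Qed.

Let path_measurableU (F : (set path_of)^nat) :
  (forall i, path_measurable (F i)) -> path_measurable (\bigcup_i F i).
Proof. exact: sigma_algebra_bigcup. Qed.

HB.instance Definition _ := @isMeasurable.Build path_display path_of
  path_measurable path_measurable0 path_measurableC path_measurableU.

Lemma measurable_path_ev (s : 'rV[R]_d) :
  measurable_fun [set: path_of] (fun z : path_of => z s).
Proof.
apply: (@measurability _ _ path_of _ setT (fun z : path_of => z s) measurable).
  by rewrite smallest_id//; exact: sigma_algebra_measurable.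
apply: subset_trans; last exact: sub_gen_smallest.
exact: (bigcup_sup (i := s)).
Qed.

Definition path_shift (t : 'rV[R]_d) (z : path_of) : path_of :=
  PathOf (paths_shift t (path_valP z)).

End path_space.
Arguments pathSpace : clear implicits.

Section inverse_density.
Context dO (Omega : measurableType dO) {R : realType} {d : nat}
  (H : pathSpace R d).
Variables (P0 : {measure set Omega -> \bar R}) (Z : {mfun Omega >-> path_of H}).
Local Open Scope ereal_scope.

(* dP = (1 / Z_0) dP0 *)
Definition inv_density_measure (A : set Omega) : \bar R :=
  \int[P0]_(w in A) ((Z w 0%R)^-1)%:E.

Let inv_density_measure0 : inv_density_measure set0 = 0.
Proof. exact: integral_set0. Qed.

Let invZ_ge0 w : 0 <= ((Z w 0%R)^-1)%:E.
Proof. by rewrite lee_fin invr_ge0; exact/paths_ge0/path_valP. Qed.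

Let inv_density_measure_ge0 A : 0 <= inv_density_measure A.
Proof. exact: integral_ge0. Qed.

Let measurable_invZ : measurable_fun [set: Omega] (fun w => (Z w 0%R)^-1%R).
Proof.
apply: (@measurableT_comp _ _ _ _ _ _ (@GRing.inv R)); last first.
  exact: (measurableT_comp (@measurable_path_ev _ _ H 0%R) (measurable_funPT Z)).
have -> : [set: R] = [set 0%R] `|` [set~ 0%R] by rewrite setUv.
apply/measurable_funU => //; first exact: measurableC.
split; first exact: measurable_fun_set1.
apply: open_continuous_measurable_fun.
  by apply: closed_openC; exact: closed_eq.
by move=> x; rewrite inE /= => /eqP x0; exact: inv_continuous.
Qed.

Let inv_density_measure_sigma_additive :
  semi_sigma_additive inv_density_measure.
Proof.
by apply: semi_sigma_additive_nng_induced => //; exact/measurable_EFinP.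
Qed.

HB.instance Definition _ := isMeasure.Build _ _ _ inv_density_measure
  inv_density_measure0 inv_density_measure_ge0
  inv_density_measure_sigma_additive.

End inverse_density.

Section shifts.
Context {R : realType} {d : nat}.

Definition is_action (G : Type) (theta : 'rV[R]_d -> G -> G) : Prop :=
  (forall g, theta 0 g = g) /\
  (forall s t g, theta (s + t) g = theta s (theta t g)).

Definition shift_measurable dG (G : measurableType dG)
    (theta : 'rV[R]_d -> G -> G) : Prop :=
  measurable_fun [set: 'rV[R]_d * G] (fun p => theta p.1 p.2).

Definition prod_shift (G1 G2 : Type) (theta1 : 'rV[R]_d -> G1 -> G1)
    (theta2 : 'rV[R]_d -> G2 -> G2) (t : 'rV[R]_d) (p : G1 * G2) : G1 * G2 :=
  (theta1 t p.1, theta2 t p.2).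

End shifts.

Definition eq_distr {R : realType} {dO dG} {Omega : measurableType dO}
    {G : measurableType dG} (P : set Omega -> \bar R) (Y1 Y2 : Omega -> G) : Prop :=
  forall A, measurable A -> pushforward P Y1 A = pushforward P Y2 A.

Definition stationary {R : realType} {d : nat} {dO dG}
    {Omega : measurableType dO} {G : measurableType dG}
    (theta : 'rV[R]_d -> G -> G) (P : set Omega -> \bar R) (W : Omega -> G) : Prop :=
  forall t, eq_distr P (fun w => theta t (W w)) W.

Definition has_density_field {R : realType} {d : nat} {Omega : Type}
    {H : pathSpace R d} (xi : Omega -> lfmeasure R d) (Z : Omega -> path_of H) : Prop :=
  forall w (B : set 'rV[R]_d), measurable B ->
    xi w B = (\int[lebesgue_rV d]_(s in B) (Z w s)%:E)%E.

Definition msupport {R : realType} {d : nat} (mu : set 'rV[R]_d -> \bar R) :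
    set 'rV[R]_d :=
  [set x | forall U, open U -> U x -> (0 < mu U)%E].

(* mu( . | A); it is identically 0 when mu A is 0 or +oo. *)
Definition cond_measure {R : realType} {T : Type} (mu : set T -> \bar R)
    (A B : set T) : \bar R :=
  (mu (B `&` A) / mu A)%E.

(* The law of (w, U_C, V_C) on the canonical extension of (Omega, P): given w,
   U_C is uniform on C; given w and U_C = u, V_C has law xi w conditioned on
   C - u. *)
Definition randomized_measure {R : realType} {d : nat} {dO}
    {Omega : measurableType dO} (P : {measure set Omega -> \bar R})
    (xi : Omega -> lfmeasure R d) (C : set 'rV[R]_d)
    (A : set (Omega * 'rV[R]_d * 'rV[R]_d)) : \bar R :=
  (\int[P]_w \int[cond_measure (lebesgue_rV d) C]_u
     cond_measure (xi w) [set y - u | y in C]%R [set v | A (w, u, v)])%E.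

(* The random element (w, u, v) of the extension carries W, xi, U_C = u and
   V_C = v; closure C `\` C° is the boundary of C. *)
Definition mass_stationary {R : realType} {d : nat} {dO dG}
    {Omega : measurableType dO} {G : measurableType dG}
    (theta : 'rV[R]_d -> G -> G) (P : {measure set Omega -> \bar R})
    (W : Omega -> G) (xi : Omega -> lfmeasure R d) : Prop :=
  {ae P, forall w, msupport (xi w) 0} /\
  forall C : set 'rV[R]_d, measurable C -> bounded_set C ->
    (0 < lebesgue_rV d C)%E -> lebesgue_rV d (closure C `\` C°) = 0%E ->
    eq_distr (randomized_measure P xi C)
      (fun '(w, u, v) => (prod_shift theta lfmeasure_shift v (W w, xi w), v + u))
      (fun '(w, u, v) => ((W w, xi w), u)).

Definition palm_version {R : realType} {d : nat} {dO dG}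
    {Omega : measurableType dO} {G : measurableType dG}
    (theta : 'rV[R]_d -> G -> G) (P0 P : {measure set Omega -> \bar R})
    (W : Omega -> G) (xi : Omega -> lfmeasure R d) : Prop :=
  stationary (prod_shift theta lfmeasure_shift) P (fun w => (W w, xi w)) /\
  forall f : G * lfmeasure R d -> \bar R,
    measurable_fun [set: G * lfmeasure R d] f -> (forall x, 0 <= f x)%E ->
  forall B : set 'rV[R]_d, measurable B -> (0 < lebesgue_rV d B < +oo)%E ->
    (\int[P0]_w f (W w, xi w) =
     (\int[P]_w \int[xi w]_(t in B)
        f (prod_shift theta lfmeasure_shift t (W w, xi w))) / lebesgue_rV d B)%E.

(* Main.v *)
(* Since Z > 0, the law of (U_C, V_C) given w has density
   1_C(u) 1_C(u+v) Z_v / (lam(C) xi(C-u)) with respect to Lebesgue measure.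
   Test mass-stationarity against F((x, z, m), t) = 1_A(x, z, m) 1_B(t) / z(0) for
   B inside C: on one side V_C integrates out and leaves P(Y in A) lam(B) / lam(C),
   where Y = ((X, Z), xi); on the other side the factor Z_v cancels and leaves
     E0 \int_C du \int dv 1_A(theta_v Y) 1_B(u+v) / (lam(C) xi(C-u)).
   If B + r is also inside C, translating v by r turns the expression for
   (theta_r^-1 A, B) into the one for (A, B + r), so
   P(theta_r Y in A) lam(B) = P(Y in A) lam(B + r).  The Palm formula
   then follows from stationarity, Tonelli's theorem and xi(dt) = Z_t dt. *)

Require Import Defs.
From HB Require Import structures.
From mathcomp Require Import all_boot all_order all_algebra.
From mathcomp Require Import all_classical all_reals all_analysis measurable_realfun.
From mathcomp Require Import ring lra.
Import numFieldNormedType.Exports.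
Import Order.TTheory GRing.Theory Num.Theory.

Set Implicit Arguments.
Unset Strict Implicit.
Unset Printing Implicit Defensive.

Local Open Scope classical_set_scope.
Local Open Scope ring_scope.

(** * Integrals against measures with a density, and their push-forwards *)

Section density.
Context d (T : measurableType d) (R : realType).
Local Open Scope ereal_scope.
Import HBNNSimple.

(** Simple functions reduce the formula to indicators, where it is the hypothesis on [nu]; monotone
    convergence on both sides then reaches [f]. *)
Lemma ge0_integral_density (mu nu : {measure set T -> \bar R}) (g : T -> R)
    (f : T -> \bar R) :
  measurable_fun setT g -> (forall x, 0 <= g x)%R ->
  (forall A, measurable A -> nu A = \int[mu]_(x in A) (g x)%:E) ->
  measurable_fun setT f -> (forall x, 0 <= f x) ->
  \int[nu]_x f x = \int[mu]_x (f x * (g x)%:E).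
Proof.
move=> mg g0 nuE mf f0; pose h := nnsfun_approx measurableT mf.
have cvgh x : EFin \o h ^~ x @ \oo --> f x by exact: cvg_nnsfun_approx.
have mEg : measurable_fun setT (EFin \o g) by exact/measurable_EFinP.
have -> : \int[nu]_x f x = lim (\int[nu]_x (EFin \o h n) x @[n --> \oo]).
  rewrite -monotone_convergence//.
  - by apply: eq_integral => x _; apply/esym/cvg_lim => //; exact: cvgh.
  - by move=> n; exact/measurable_EFinP.
  - by move=> n x _ /=; rewrite lee_fin.
  - by move=> x _ a b ab; rewrite lee_fin; exact/lefP/nd_nnsfun_approx.
have -> : \int[mu]_x (f x * (g x)%:E) =
    lim (\int[mu]_x ((EFin \o h n) x * (g x)%:E) @[n --> \oo]).
  rewrite -monotone_convergence//.
  - apply: eq_integral => x _; apply/esym/cvg_lim => //.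
    by apply: cvgeZr => //; exact: cvgh.
  - by move=> n; apply: emeasurable_funM => //; exact/measurable_EFinP.
  - by move=> n x _ /=; rewrite mule_ge0// lee_fin.
  - move=> x _ a b ab; rewrite lee_wpmul2r ?lee_fin//.
    exact/lefP/nd_nnsfun_approx.
apply/congr_lim/funext => n.
transitivity (\int[nu]_x
   (\sum_(y \in range (h n)) (y * \1_(h n @^-1` [set y]) x)%:E)).
  by apply: eq_integral => t tE; rewrite /= fimfunE -fsumEFin.
have indich r : measurable_fun setT (fun x => (r * \1_(h n @^-1` [set r]) x)%:E).
  by apply/measurable_EFinP; exact: measurable_funM.
rewrite ge0_integral_fsum//; last by move=> m y _; exact: nnfun_muleindic_ge0.
transitivity (\int[mu]_x (\sum_(y \in range (h n))
    (y * \1_(h n @^-1` [set y]) x)%:E * (g x)%:E)); last first.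
  apply: eq_integral => x _.
  rewrite -ge0_mule_fsuml => [|y]; last exact: nnfun_muleindic_ge0.
  by rewrite fsumEFin // -(fimfunE _ x).
rewrite ge0_integral_fsum//; last 2 first.
  - by move=> y; apply: emeasurable_funM.
  - move=> m y _; apply: mule_ge0; last by rewrite lee_fin.
    by rewrite EFinM nnfun_muleindic_ge0.
apply: eq_fsbigr => r rhn.
under eq_integral do rewrite EFinM.
rewrite integralZl_indic_nnsfun => //.
under [RHS]eq_integral do rewrite EFinM -muleA.
rewrite [RHS]ge0_integralZl//.
- under [in RHS]eq_integral do rewrite muleC.
  rewrite [in RHS](eq_integral ((EFin \o g) \_ (h n @^-1` [set r]))); last first.
    by move=> x xE; rewrite epatch_indic.
  by rewrite -integral_mkcond -nuE// integral_indic// setIT.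
- by apply: emeasurable_funM => //; exact/measurable_EFinP.
- by move=> t Et; rewrite mule_ge0 ?lee_fin.
- by move: rhn; rewrite inE => -[t _ <-]; rewrite lee_fin.
Qed.

Section density_measure.
Variables (mu : {measure set T -> \bar R}) (g : T -> R).
Hypotheses (mg : measurable_fun setT g) (g0 : forall x, (0 <= g x)%R).

(** The two proofs are arguments so that the measure instance declared below, which depends on them,
    can be inferred from the term. *)
Definition density_measure of measurable_fun setT g & (forall x, (0 <= g x)%R) :=
  fun A : set T => \int[mu]_(x in A) (g x)%:E.

Let nu := density_measure mg g0.

Let nu0 : nu set0 = 0. Proof. exact: integral_set0. Qed.

Let nu_ge0 A : 0 <= nu A.
Proof. by apply: integral_ge0 => x _; rewrite lee_fin. Qed.

Let nu_sigma_additive : semi_sigma_additive nu.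
Proof.
apply: semi_sigma_additive_nng_induced => [|x]; last by rewrite lee_fin.
exact/measurable_EFinP.
Qed.

HB.instance Definition _ := isMeasure.Build _ _ _ nu
  nu0 nu_ge0 nu_sigma_additive.

End density_measure.

(** Both sides integrate [F] against push-forwards of the measure with density [g], and these agree
    on measurable sets by hypothesis. This passes from equality in distribution to test
    functions. *)
Lemma eq_density_pushforward d' (G : measurableType d')
    (mu : {measure set T -> \bar R}) (g : T -> R) (Y1 Y2 : T -> G)
    (F : G -> \bar R) :
  measurable_fun setT g -> (forall x, 0 <= g x)%R ->
  measurable_fun setT Y1 -> measurable_fun setT Y2 ->
  (forall A, measurable A -> \int[mu]_(x in Y1 @^-1` A) (g x)%:E =
                             \int[mu]_(x in Y2 @^-1` A) (g x)%:E) ->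
  measurable_fun setT F -> (forall y, 0 <= F y) ->
  \int[mu]_x (F (Y1 x) * (g x)%:E) = \int[mu]_x (F (Y2 x) * (g x)%:E).
Proof.
move=> mg g0 mY1 mY2 Y12 mF F0.
pose nu : {measure set T -> \bar R} := density_measure mu mg g0.
have E Y : measurable_fun setT Y ->
    \int[mu]_x (F (Y x) * (g x)%:E) = \int[pushforward nu Y]_y F y.
  move=> mY; rewrite ge0_integral_pushforward//.
  rewrite preimage_setT; apply/esym.
  apply: (ge0_integral_density mg g0) => //.
    exact: measurableT_comp.
  by move=> x; exact: F0.
rewrite !E//; apply: eq_measure_integral => A mA _.
exact: Y12.
Qed.

End density.

(** Carries the sigma-finiteness assumed of the law of [((X, Z), xi)] back to [Omega], where
    Tonelli's theorem is applied. *)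
Lemma sigma_finite_pushforward d d' (T : measurableType d) (G : measurableType d')
    (R : realType) (mu : {measure set T -> \bar R}) (Y : T -> G) :
  measurable_fun setT Y -> sigma_finite setT (pushforward mu Y) ->
  sigma_finite setT mu.
Proof.
move=> mY [F FT Foo]; exists (fun n => Y @^-1` F n).
  by rewrite -preimage_bigcup -FT preimage_setT.
move=> n; have [mF Fn] := Foo n; split => //.
by rewrite -[X in measurable X]setTI; exact: mY.
Qed.

(** * Translation invariance of Lebesgue measure on R^d *)

Section lebesgue_rV_translation.
Context {R : realType}.

Lemma lebesgue_measure_translate (a : R) (A : set (measurableTypeR R)) :
  measurable A ->
  pushforward lebesgue_measure
    ((fun x => x + a) : measurableTypeR R -> measurableTypeR R) A =
  lebesgue_measure A.
Proof.
move=> mA; apply/esym/lebesgue_measure_unique => //=.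
  exact: measurable_funD.
move=> _ _ [[b c] _ <-].
rewrite /pushforward (_ : _ @^-1` _ = `]b - a, c - a]%classic); last first.
  by apply/seteqP; split => x /=; rewrite !in_itv/= ltrBlDr lerBrDr.
rewrite !lebesgue_measure_itv/= !lte_fin ltrD2r; case: ifP => // _.
by rewrite -!EFinD opprB addrA subrK.
Qed.

Lemma measurable_addr_rV d (t : 'rV[R]_d) :
  measurable_fun [set: 'rV[R]_d] (fun x => x + t).
Proof.
apply: measurable_fun_rV => j; under eq_fun do rewrite mxE.
by apply: measurable_funD => //; exact: measurable_coord.
Qed.

(** Induction on [d], cutting along the first coordinate: the sections are translated by the tail
    [t'] of [t], and their masses, as a function of the first coordinate, by [t ord0 ord0]. *)
Lemma lebesgue_rV_translate d (t : 'rV[R]_d) (A : set 'rV[R]_d) :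
  measurable A ->
  pushforward (lebesgue_rV d) (fun x => x + t) A = lebesgue_rV d A.
Proof.
elim: d t A => [|d IH] t A mA.
  by rewrite /pushforward (_ : _ @^-1` A = A)//; apply/seteqP; split => x;
    rewrite /= (_ : x + t = x)//; apply/rowP => -[].
pose t' : 'rV[R]_d := \row_j t ord0 (lift ord0 j).
have mcA : measurable (@cons_rV R d @^-1` A).
  by rewrite -[X in measurable X]setTI; exact: measurable_cons_rV.
rewrite [in LHS]/= /pushforward /lebesgue_cons /pushforward /product_measure1.
pose h (x : measurableTypeR R) := lebesgue_rV d (xsection (@cons_rV R d @^-1` A) x).
have mh : measurable_fun setT h by exact: measurable_fun_xsection.
transitivity (\int[lebesgue_measure]_x h (x + t ord0 ord0)%R)%E.
  apply: eq_integral => x _; rewrite -[RHS](IH t'); last exact: measurable_xsection.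
  congr (lebesgue_rV d _); apply/seteqP; split => v; rewrite /xsection/= !inE/=;
    (rewrite (_ : cons_rV (x, v) + t = cons_rV (x + t ord0 ord0, v + t'))//;
     apply/rowP => j; rewrite !mxE; case: unliftP => [k|] ->/=; rewrite ?mxE//).
rewrite [RHS]/= /lebesgue_cons /pushforward /product_measure1.
rewrite -[RHS]/(\int[lebesgue_measure]_x h x)%E.
pose tau (x : measurableTypeR R) : measurableTypeR R := x + t ord0 ord0.
have mtau : measurable_fun setT tau by exact: measurable_funD.
transitivity (\int[pushforward lebesgue_measure tau]_x h x)%E.
  by rewrite ge0_integral_pushforward.
by apply: eq_measure_integral => B mB _; exact: lebesgue_measure_translate.
Qed.

End lebesgue_rV_translation.

(** * Translated integrals, and cubes with null boundary *)

Section lebesgue_rV_box.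
Context {R : realType}.
Local Open Scope ereal_scope.

Lemma ge0_integral_translate_rV d (t : 'rV[R]_d) (f : 'rV[R]_d -> \bar R) :
  measurable_fun setT f -> (forall x, 0 <= f x) ->
  \int[lebesgue_rV d]_x f (x + t)%R = \int[lebesgue_rV d]_x f x.
Proof.
move=> mf f0; have mt := @measurable_addr_rV R d t.
transitivity (\int[pushforward (lebesgue_rV d) (fun x => x + t)%R]_x f x).
  by rewrite ge0_integral_pushforward.
by apply: eq_measure_integral => B mB _; exact: lebesgue_rV_translate.
Qed.

Lemma measurable_coord_preimage d (j : 'I_d) (A : set R) :
  measurable A -> measurable [set x : 'rV[R]_d | A (x ord0 j)].
Proof.
by move=> mA; rewrite -[X in measurable X]setTI; exact: measurable_coord.
Qed.

(** Once the first coordinate is split off, the hyperplane is a product with a null factor; the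
    other factor may be infinite, and the product is still 0 because [+oo * 0 = 0] in [\bar R]. *)
Lemma lebesgue_rV_hyperplane d (j : 'I_d) (a : R) :
  lebesgue_rV d [set x : 'rV[R]_d | x ord0 j = a] = 0.
Proof.
elim: d j => [[]//|d IH] j.
rewrite [LHS]/= /lebesgue_cons /pushforward.
have [k ->|->] := unliftP ord0 j.
  rewrite (_ : _ @^-1` _ = setT `*` [set v : 'rV[R]_d | v ord0 k = a]).
    rewrite product_measure1E// ?IH ?mule0//.
    exact: (measurable_coord_preimage k (measurable_set1 a)).
  by apply/seteqP; split => -[x v] /=; rewrite mxE liftK//= => -[].
rewrite (_ : _ @^-1` _ = ([set a] : set (measurableTypeR R)) `*` setT).
  rewrite product_measure1E//.
  by rewrite -[X in X * _]/(lebesgue_measure [set a]) lebesgue_measure_set1 mul0e.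
by apply/seteqP; split => -[x v] /=; rewrite mxE unlift_none//= => -[].
Qed.

Lemma coord_le_norm d (x : 'rV[R]_d) (j : 'I_d) : (`|x ord0 j| <= `|x|)%R.
Proof.
rewrite {2}/Num.norm/= mx_normrE.
by apply/bigmax_geP; right; exists (ord0, j).
Qed.

(** Half-open, to match the boxes measured by [lebesgue_rV_box]. *)
Definition cube d (M : R) : set 'rV[R]_d :=
  [set x | forall j, (- M < x ord0 j <= M)%R].

Lemma measurable_cube d M : measurable (@cube d M).
Proof.
rewrite (_ : @cube d M =
    \bigcap_(j in [set: 'I_d]) [set x : 'rV[R]_d | `](- M)%R, M]%classic (x ord0 j)]).
  by apply: fin_bigcap_measurable => // j _; exact: measurable_coord_preimage.
by apply/seteqP; split => x /= H j; [move=> _; rewrite /= in_itv; exact: H|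
  have := H j I; rewrite /= in_itv].
Qed.

Lemma bounded_cube d M : (0 <= M)%R -> bounded_set (@cube d M).
Proof.
move=> M0; exists M; split; first exact: num_real.
move=> N MN x Bx /=.
rewrite /Num.norm/= mx_normrE; apply/bigmax_leP.
split => [|[i j] _ /=]; first exact/ltW/(le_lt_trans M0).
rewrite (ord1 i) (le_trans _ (ltW MN))// ler_norml.
by have /andP[/ltW -> ->] := Bx j.
Qed.

Lemma lebesgue_rV_cube d M : (0 <= M)%R ->
  lebesgue_rV d (@cube d M) = ((M *+ 2)%R ^+ d)%:E.
Proof.
move=> M0; pose c (a : R) : 'rV[R]_d := const_mx a.
have := @lebesgue_rV_box R d (c (- M)%R) (c M).
have -> : [set x : 'rV[R]_d | forall j, (c (- M)%R ord0 j < x ord0 j <= c M ord0 j)%R]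
    = @cube d M.
  by apply/seteqP; split => x /= + j => /(_ j); rewrite !mxE.
move=> -> => [|j]; last by rewrite !mxE (le_trans _ M0)// oppr_le0.
congr (_%:E); under eq_bigr do rewrite !mxE opprK -mulr2n.
by rewrite prodr_const card_ord.
Qed.

(** The boundary lies in the finitely many hyperplanes [x_j = M] and [x_j = - M], which are null. *)
Lemma cube_boundary d M :
  lebesgue_rV d (closure (@cube d M) `\` (@cube d M)°) = 0.
Proof.
apply: measure_negligible.
  apply: measurableD; last by apply: open_measurable_rV; exact: open_interior.
  rewrite -[closure _]setCK; apply: measurableC; apply: open_measurable_rV.
  by apply: closed_openC; exact: closed_closure.
pose bd (j : 'I_d) :=
  [set x : 'rV[R]_d | x ord0 j = M] `|` [set x : 'rV[R]_d | x ord0 j = (- M)%R].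
apply: (@negligibleS _ _ _ _ (\big[setU/set0]_(j < d) bd j)); last first.
  elim/big_ind : _ => [|A B|j _]; [exact: negligible_set0|exact: negligibleU|].
  have nj a : (lebesgue_rV d).-negligible [set x : 'rV[R]_d | x ord0 j = a].
    apply/negligibleP; last exact: lebesgue_rV_hyperplane.
    exact: (measurable_coord_preimage j (measurable_set1 a)).
  exact: negligibleU.
move=> x [cx nix].
have bdx j : bd j x -> (\big[setU/set0]_(j < d) bd j) x.
  by move=> bdj; rewrite (bigD1 j)//=; left.
have {}cx j : (- M <= x ord0 j <= M)%R.
  apply/negPn/negP => xM.
  have : nbhs x [set y : 'rV[R]_d | ~~ (- M <= y ord0 j <= M)%R].
    apply: open_nbhs_nbhs; split => //.
    have -> : [set y : 'rV[R]_d | ~~ (- M <= y ord0 j <= M)%R] =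
       (fun y : 'rV[R]_d => y ord0 j) @^-1` (~` `[(- M)%R, M]%classic).
      by apply/seteqP; split => y /=; rewrite in_itv/= => /negP.
    apply: open_comp; first by move=> y _; exact: coord_continuous.
    exact/closed_openC/interval_closed.
  move=> /cx[y [/(_ j)/andP[/ltW My yM] /=]].
  by rewrite My yM.
(* Off these hyperplanes all the inequalities are strict at [x], hence near [x], which would make
   [x] an interior point. *)
apply: contrapT => nbd; apply: nix.
have nj j : nbhs x [set y : 'rV[R]_d | (- M < y ord0 j < M)%R].
  have : open [set y : 'rV[R]_d | (- M < y ord0 j < M)%R].
    have -> : [set y : 'rV[R]_d | (- M < y ord0 j < M)%R] =
       (fun y : 'rV[R]_d => y ord0 j) @^-1` (`](- M)%R, M[%classic).
      by apply/seteqP; split => y /=; rewrite in_itv.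
    apply: open_comp; first by move=> y _; exact: coord_continuous.
    exact: interval_open.
  move=> oj; apply: open_nbhs_nbhs; split => //=.
  have /andP[] := cx j; rewrite !le_eqVlt => /orP[/eqP xM|->].
    by exfalso; apply/nbd/(bdx j); right.
  by move=> /orP[/eqP xM|->//]; exfalso; apply/nbd/(bdx j); left.
have nx := @filter_forall _ _ _ (nbhs x) (nbhs_filter x) nj.
change (nbhs x (@cube d M)); apply: (@filterS _ _ (nbhs_filter x) _ _ _ nx) => y yM j.
by have /andP[-> /ltW] := yM j.
Qed.

End lebesgue_rV_box.

(** A vanishing integral would make [f] zero almost everywhere on [D], hence [D] null. *)
Lemma integral_gt0 d (T : measurableType d) (R : realType)
    (mu : {measure set T -> \bar R}) (D : set T) (f : T -> \bar R) :
  measurable D -> measurable_fun D f -> (forall x, D x -> 0 < f x)%E ->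
  (0 < mu D)%E -> (0 < \int[mu]_(x in D) f x)%E.
Proof.
move=> mD mf f0 muD; rewrite lt0e integral_ge0 ?andbT; last first.
  by move=> x /f0/ltW.
apply/eqP => If0.
have : (\int[mu]_(x in D) `|f x| = 0)%E.
  rewrite -[RHS]If0; apply: eq_integral => x /[!inE] /f0/ltW; exact: gee0_abs.
move=> /(ae_eq_integral_abs mu mD mf)[N [mN N0 DN]].
have DN' : D `<=` N.
  by move=> x Dx; apply: DN => /= /(_ Dx) fx0; have := f0 x Dx; rewrite fx0 ltxx.
suff : (mu D <= 0)%E by rewrite leNgt muD.
by rewrite -N0 le_measure ?inE.
Qed.

(** * Measurability of random measures through evaluations at Borel sets *)

Lemma measurable_lfmeasure_ev (R : realType) d (B : set 'rV[R]_d) :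
  measurable B -> measurable_fun setT (fun mu : lfmeasure R d => mu B).
Proof.
move=> mB.
apply: (@measurability _ _ (lfmeasure R d) _ setT (fun mu => mu B) measurable).
  by rewrite smallest_id//; exact: sigma_algebra_measurable.
apply: subset_trans; last exact: sub_gen_smallest.
exact: (bigcup_sup (i := B)).
Qed.

Lemma measurable_fun_lfmeasure (R : realType) d d' (T : measurableType d')
    (f : T -> lfmeasure R d) :
  (forall B, measurable B -> measurable_fun setT (fun x => f x B)) ->
  measurable_fun setT f.
Proof.
move=> mf; apply: (@measurability _ _ _ _ _ _ (\bigcup_(B in @measurable _ 'rV[R]_d)
  preimage_set_system setT (fun mu : lfmeasure R d => mu B) measurable)) => //.
move=> _ [_ [B mB [D mD <-]] <-]; rewrite !setTI.
by rewrite -[X in measurable X]setTI; exact: (mf B mB).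
Qed.

Lemma measurable_lfmeasure_shift1 (R : realType) d (t : 'rV[R]_d) :
  measurable_fun setT (@lfmeasure_shift R d t).
Proof.
apply: measurable_fun_lfmeasure => B mB.
exact: measurable_lfmeasure_ev (measurable_translate t mB).
Qed.

(** * Random measures with a density field *)

Section density_field.
Context (R : realType) (d : nat) (dO : measure_display)
  (Omega : measurableType dO) (H : pathSpace R d).
Hypothesis H_meas : shift_measurable (@path_shift R d H).
Variable Z : {mfun Omega >-> path_of H}.
Local Notation V := ('rV[R]_d).
Local Open Scope ereal_scope.

(** Since [Z_s] is the value at 0 of the path shifted by [s], joint measurability in [(w, s)]
    follows from shift-measurability of the path space. *)
Lemma measurable_field_eval :
  measurable_fun [set: Omega * V] (fun p => Z p.1 p.2).
Proof.
have -> : (fun p : Omega * V => Z p.1 p.2 : R) =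
    (fun z : path_of H => z 0%R) \o
    (fun q : V * path_of H => path_shift q.1 q.2) \o
    (fun p : Omega * V => (p.2, Z p.1)).
  by apply/funext => p /=; rewrite addr0.
apply: measurableT_comp; first apply: measurableT_comp.
- exact: measurable_path_ev.
- exact: H_meas.
- apply: measurable_fun_pair => //.
  exact: (measurableT_comp (@measurable_funPT _ _ _ _ Z)).
Qed.

Variable xi : {mfun Omega >-> lfmeasure R d}.
Hypothesis xi_density : has_density_field xi Z.

Lemma image_addr (t : V) (B : set V) :
  [set (x + t)%R | x in B] = [set x | B (x - t)%R].
Proof.
apply/seteqP; split => [_ [x Bx <-]|x Bx] /=; first by rewrite addrK.
by exists (x - t)%R; rewrite ?subrK.
Qed.

(** The parameter [t] moves from the domain of integration into the integrand, where Tonelli's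
    theorem gives measurability in [(w, t)]. *)
Lemma density_field_translate w (t : V) (B : set V) : measurable B ->
  xi w [set (x + t)%R | x in B] =
  \int[lebesgue_rV d]_s (\1_B (s - t) * Z w s)%:E.
Proof.
move=> mB; rewrite xi_density; last exact: measurable_translate.
rewrite integral_mkcond; apply: eq_integral => s _.
rewrite epatch_indic EFinM muleC; congr (_%:E * _).
by rewrite image_addr !indicE; congr (_%:R); apply/idP/idP; rewrite !inE.
Qed.

Lemma measurable_density_field_translate (B : set V) : measurable B ->
  measurable_fun [set: Omega * V] (fun p => xi p.1 [set (x + p.2)%R | x in B]).
Proof.
move=> mB.
pose f (q : (Omega * V) * V) := (\1_B (q.2 - q.1.2) * Z q.1.1 q.2)%:E.
rewrite [X in measurable_fun _ X](_ : _ =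
    fun p => \int[lebesgue_rV d]_s f (p, s)); last first.
  by apply/funext => p; exact: density_field_translate.
apply: (measurable_fun_fubini_tonelli_F f); last first.
  by move=> q; rewrite lee_fin mulr_ge0//; apply: paths_ge0; exact: path_valP.
have mq : measurable_fun setT (fun q : (Omega * V) * V => (q.1.1, q.2)).
  by apply: measurable_fun_pair => //; exact: measurableT_comp.
apply/measurable_EFinP; apply: measurable_funM; last first.
  exact: (measurableT_comp measurable_field_eval mq).
apply: (measurableT_comp (measurable_indic mB)).
apply: measurable_fun_rV => j; under eq_fun do rewrite !mxE.
apply: measurable_funB.
  exact: (measurableT_comp (@measurable_coord R d j)).
apply: (measurableT_comp (@measurable_coord R d j)).
exact: measurableT_comp.
Qed.

Lemma measurable_lfmeasure_shift :
  measurable_fun [set: Omega * V] (fun p => lfmeasure_shift p.2 (xi p.1)).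
Proof.
apply: measurable_fun_lfmeasure => B mB.
exact: (measurable_density_field_translate mB).
Qed.

Hypothesis Z_gt0 : forall w s, (0 < Z w s)%R.

(** Guarantees that the windows [C - u] have positive mass, so that conditioning [xi] on them is
    never degenerate. *)
Lemma density_field_gt0 w (B : set V) :
  measurable B -> 0 < lebesgue_rV d B -> 0 < xi w B.
Proof.
move=> mB B0; rewrite xi_density//; apply: integral_gt0 => // [|s _].
  apply/measurable_EFinP; apply: measurable_funTS.
  exact: (measurable_fun_pair2 w measurable_field_eval).
by rewrite lte_fin.
Qed.

Lemma ge0_integral_density_field w (f : V -> \bar R) :
  measurable_fun setT f -> (forall s, 0 <= f s) ->
  \int[xi w]_s f s = \int[lebesgue_rV d]_s (f s * (Z w s)%:E).
Proof.
move=> mf f0; apply: ge0_integral_density => //.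
- exact: (measurable_fun_pair2 w measurable_field_eval).
- by move=> s; exact/ltW.
- by move=> A mA; exact: xi_density.
Qed.

End density_field.

Lemma measurable_invr (R : realType) d (T : measurableType d) (f : T -> R) :
  measurable_fun setT f -> measurable_fun setT (fun x => (f x)^-1).
Proof.
move=> mf; apply: (@measurableT_comp _ _ _ _ _ _ (@GRing.inv R)) => //.
rewrite -(setUv [set 0]); apply/measurable_funU => //; first exact: measurableC.
split; first exact: measurable_fun_set1.
apply: open_continuous_measurable_fun; first exact/closed_openC/closed_eq.
by move=> x; rewrite inE /= => /eqP x0; exact: inv_continuous.
Qed.

(** * Integration against conditioned measures *)

Section cond_measure.
Context d (T : measurableType d) (R : realType) (mu : {measure set T -> \bar R}).
Local Open Scope ereal_scope.

Lemma ge0_integral_cond_measure (C : set T) (f : T -> \bar R) :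
  measurable C -> 0 < mu C < +oo ->
  measurable_fun setT f -> (forall x, 0 <= f x) ->
  \int[cond_measure mu C]_x f x =
  \int[mu]_x (f x * ((fine (mu C))^-1 * \1_C x)%:E).
Proof.
move=> mC /andP[C0 Coo] mf f0.
have muC : mu C = (fine (mu C))%:E by rewrite fineK// ge0_fin_numE ?measure_ge0.
have c0 : (0 <= (fine (mu C))^-1)%R by rewrite invr_ge0 fine_ge0.
have fC : (fine (mu C) != 0)%R by rewrite -eqe -muC gt_eqF.
(* [cond_measure] is a bare set function; as a rescaled restriction it becomes a measure, with
   density [1_C / mu C]. *)
have -> : cond_measure mu C = mscale (NngNum c0) (mrestr mu mC).
  by apply/funext => A; rewrite /cond_measure /mscale /mrestr/= muleC [in LHS]muC inver
    (negbTE fC).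
apply: ge0_integral_density => //.
  by apply: measurable_funM => //; exact: measurable_indic.
move=> A mA; under eq_integral do rewrite EFinM.
rewrite ge0_integralZl//; last first.
  by apply/measurable_EFinP; exact: measurable_indic.
by rewrite integral_indic// setIC.
Qed.

End cond_measure.

(** * Composition of shifts on paths and on measures *)

Lemma path_of_ext (R : realType) d (H : pathSpace R d) (z1 z2 : path_of H) :
  (forall s, z1 s = z2 s) -> z1 = z2.
Proof.
case: z1 z2 => [z1 H1] [z2 H2] /= /funext z12; rewrite z12 in H1 *.
by congr PathOf; exact: Prop_irrelevance.
Qed.

Lemma lfmeasure_ext (R : realType) d (m1 m2 : lfmeasure R d) :
  (forall B, m1 B = m2 B) -> m1 = m2.
Proof.
case: m1 m2 => [m1 H1] [m2 H2] /= /funext/eq_measure m12; rewrite m12 in H1 *.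
by congr LFMeasure; exact: Prop_irrelevance.
Qed.

Lemma path_shiftD (R : realType) d (H : pathSpace R d) (s t : 'rV[R]_d)
    (z : path_of H) : path_shift (s + t) z = path_shift s (path_shift t z).
Proof. by apply: path_of_ext => u /=; rewrite addrA (addrC s). Qed.

Lemma lfmeasure_shiftD (R : realType) d (s t : 'rV[R]_d) (m : lfmeasure R d) :
  lfmeasure_shift (s + t) m = lfmeasure_shift s (lfmeasure_shift t m).
Proof.
apply: lfmeasure_ext => B /=; rewrite /translate_measure/= /translate_measure.
congr (m _); apply/seteqP; split => [_ [x Bx <-]|_ [_ [x Bx <-] <-]].
  by exists (x + s); [exists x|rewrite addrA].
by exists x => //; rewrite addrA.
Qed.

Section product_sigma_finite.
Context d1 d2 (T1 : measurableType d1) (T2 : measurableType d2) (R : realType).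
Variables (m1 : {sigma_finite_measure set T1 -> \bar R})
  (m2 : {sigma_finite_measure set T2 -> \bar R}).

(* The instance that the library infers for [m1 \x m2] is the one for
   subprobabilities, which does not unify with this general case. *)
Definition product_sigma_finite :
    {sigma_finite_measure set (T1 * T2)%type -> \bar R} :=
  HB.pack (m1 \x m2)%E
  (@lebesgue_integral_fubini.measure_function_Measure_isSigmaFinite__to__measure_function_isSFinite _ _ _ _ _ m1 m2)
  (@lebesgue_integral_fubini.measure_function_Measure_isSigmaFinite__to__measure_function_isSigmaFinite _ _ _ _ _ m1 m2).

End product_sigma_finite.

(** * Mass-stationarity for a random measure with positive density *)

Section mass_stationary_density.
Context (R : realType) (d : nat) (dO dE : measure_display)
  (Omega : measurableType dO) (E : measurableType dE)
  (thetaE : 'rV[R]_d -> E -> E) (H : pathSpace R d).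
Hypotheses (thetaE_action : is_action thetaE)
  (thetaE_meas : shift_measurable thetaE)
  (H_meas : shift_measurable (@path_shift R d H)).
Variables (X : {mfun Omega >-> E}) (Z : {mfun Omega >-> path_of H})
  (xi : {mfun Omega >-> lfmeasure R d}).
Hypotheses (xi_density : has_density_field xi Z)
  (Z_gt0 : forall w s, 0 < Z w s).
Local Notation V := ('rV[R]_d).
Local Notation G := (E * path_of H * lfmeasure R d)%type.
Local Notation thetaW := (prod_shift thetaE (@path_shift R d H)).
Local Notation shift := (prod_shift thetaW lfmeasure_shift).
Local Notation lam := (lebesgue_rV d).
Let Y w : G := ((X w, Z w), xi w).
Local Open Scope ereal_scope.

Let shiftD s t y : shift (s + t)%R y = shift s (shift t y).
Proof.
case: y => -[x z] m; rewrite /prod_shift/= path_shiftD lfmeasure_shiftD.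
by case: thetaE_action => _ ->.
Qed.

Let measurable_Y : measurable_fun setT Y.
Proof.
apply: measurable_fun_pair; first apply: measurable_fun_pair.
- exact: (@measurable_funPT _ _ _ _ X).
- exact: (@measurable_funPT _ _ _ _ Z).
- exact: (@measurable_funPT _ _ _ _ xi).
Qed.

Let measurable_shift_Y :
  measurable_fun [set: Omega * V] (fun p => shift p.2 (Y p.1)).
Proof.
apply: measurable_fun_pair; first apply: measurable_fun_pair.
- apply: (measurableT_comp thetaE_meas (g := fun p : Omega * V => (p.2, X p.1))).
  apply: measurable_fun_pair => //.
  exact: (measurableT_comp (@measurable_funPT _ _ _ _ X)).
- apply: (measurableT_comp H_meas (g := fun p : Omega * V => (p.2, Z p.1))).
  apply: measurable_fun_pair => //.
  exact: (measurableT_comp (@measurable_funPT _ _ _ _ Z)).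
- exact: (measurable_lfmeasure_shift H_meas xi_density).
Qed.

(** For fixed [r] the shift is measurable on all of [G], so the preimage of a measurable set under
    it is again an admissible test set. *)
Let measurable_shift r : measurable_fun setT (shift r : G -> G).
Proof.
apply: measurable_fun_pair; first apply: measurable_fun_pair.
- apply: (measurableT_comp (measurable_fun_pair2 r thetaE_meas)).
  exact: measurableT_comp.
- apply: (measurableT_comp (measurable_fun_pair2 r H_meas)).
  exact: measurableT_comp.
- apply: measurableT_comp => //; exact: measurable_lfmeasure_shift1.
Qed.

Let mZ := measurable_field_eval H_meas Z.

(** * The randomized law over one window [C] *)

Section window.
Variable C : set V.
Hypotheses (mC : measurable C) (bC : bounded_set C) (C0 : 0 < lam C)
  (Coo : lam C < +oo).

Let rho w (u : V) : R := fine (xi w [set y - u | y in C]%R).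

Let rhoE w u : xi w [set y - u | y in C]%R = (rho w u)%:E.
Proof.
rewrite /rho fineK// ge0_fin_numE//.
(* [xi w (C - u)] is the mass of [C] under a shifted measure, so local finiteness applies to the
   bounded set [C] itself. *)
rewrite -[ltLHS]/(lfmeasure_shift (- u)%R (xi w) C).
exact: lfmeasure_lty.
Qed.

Let rho_gt0 w u : (0 < rho w u)%R.
Proof.
rewrite -lte_fin -rhoE; apply: (density_field_gt0 H_meas xi_density Z_gt0).
  exact: measurable_translate.
rewrite image_addr -[X in _ < X]/(pushforward lam (fun x => x - - u)%R C).
by rewrite lebesgue_rV_translate.
Qed.

Let measurable_rho : measurable_fun [set: Omega * V] (fun p => rho p.1 p.2).
Proof.
apply: (measurableT_comp (fine_measurable measurableT)).
have mN : measurable_fun [set: Omega * V] (fun p => (p.1, - p.2)%R).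
  apply: measurable_fun_pair => //; apply: measurable_fun_rV => j.
  under eq_fun do rewrite mxE.
  apply: measurableT_comp => //.
  exact: (measurableT_comp (@measurable_coord R d j)).
exact: (measurableT_comp (measurable_density_field_translate H_meas xi_density mC) mN).
Qed.

(** The normalising constant of the conditional law of [V_C]: it cancels [1 / rho] when [v] is
    integrated out. *)
Let integral_window w u :
  \int[lam]_v (\1_C (v + u) * Z w v)%:E = (rho w u)%:E.
Proof.
rewrite -rhoE (density_field_translate xi_density)//.
by apply: eq_integral => v _; rewrite opprK.
Qed.

Let c : R := ((fine (lam C))^-1)%R.

Let c_ge0 : (0 <= c)%R. Proof. by rewrite invr_ge0 fine_ge0. Qed.

(* The density of (w, U_C, V_C) with respect to P0 \x lam \x lam. *)
Let kern (p : Omega * V * V) : R :=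
  (c * \1_C p.1.2 / rho p.1.1 p.1.2 * (\1_C (p.2 + p.1.2) * Z p.1.1 p.2))%R.

Let kern_ge0 p : (0 <= kern p)%R.
Proof.
rewrite /kern; apply: mulr_ge0; last by rewrite mulr_ge0// ltW.
by apply: mulr_ge0; [exact: mulr_ge0|rewrite invr_ge0 ltW].
Qed.

Let measurable_uv : measurable_fun [set: Omega * V * V] (fun p => p.2 + p.1.2)%R.
Proof.
apply: measurable_fun_rV => j; under eq_fun do rewrite mxE.
apply: measurable_funD; first exact: (measurableT_comp (@measurable_coord R d j)).
apply: (measurableT_comp (@measurable_coord R d j)).
exact: measurableT_comp.
Qed.

Let measurable_kern : measurable_fun setT kern.
Proof.
apply: measurable_funM; first apply: measurable_funM.
- apply: measurable_funM => //; apply: (measurableT_comp (measurable_indic mC)).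
  exact: measurableT_comp.
- apply: measurable_invr; apply: (measurableT_comp measurable_rho).
  exact: measurable_fst.
- apply: measurable_funM; first exact: (measurableT_comp (measurable_indic mC)).
  have mwv : measurable_fun [set: Omega * V * V] (fun p => (p.1.1, p.2)).
    by apply: measurable_fun_pair => //; exact: measurableT_comp.
  exact: (measurableT_comp mZ mwv).
Qed.

Variable P0 : {sigma_finite_measure set Omega -> \bar R}.

Local Notation P0lam2 := (product_sigma_finite P0 lam \x lam).

Let integral3 (f : Omega * V * V -> \bar R) :
  measurable_fun setT f -> (forall p, 0 <= f p) ->
  \int[P0lam2]_p f p = \int[P0]_w \int[lam]_u \int[lam]_v f (w, u, v).
Proof.
move=> mf f0; rewrite fubini_tonelli1//.
apply: (fubini_tonelli1 (fubini_F lam f)).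
- exact: measurable_fun_fubini_tonelli_F.
- by move=> p; exact: integral_ge0.
Qed.

(** The uniform law contributes [c 1_C(u)] and the conditional law of [V_C] contributes
    [1_C(v + u) Z_v / rho]; their product is [kern]. The set function [randomized_measure] thus
    becomes, on measurable sets, a measure with a density. *)
Let randomized_measureE (A : set (Omega * V * V)) : measurable A ->
  randomized_measure P0 xi C A = \int[P0lam2]_(p in A) (kern p)%:E.
Proof.
move=> mA; rewrite [RHS]integral_mkcond.
pose f p := (kern p * \1_A p)%:E.
have mf : measurable_fun setT f.
  by apply/measurable_EFinP; apply: measurable_funM => //; exact: measurable_indic.
have f0 p : 0 <= f p by rewrite lee_fin mulr_ge0.
rewrite (eq_integral f); last first.
  by move=> p _; rewrite epatch_indic EFinM.
rewrite integral3//; apply: eq_integral => w _.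
(* [h] is [kern 1_A] at [w] without the factor [c 1_C(u)], which comes back with the uniform law of
   [u]. *)
pose h (q : V * V) :=
  ((rho w q.1)^-1 * (\1_A (w, q.1, q.2) * (\1_C (q.2 + q.1) * Z w q.2)))%:E.
have h0 q : 0 <= h q.
  rewrite lee_fin; apply: mulr_ge0; first by rewrite invr_ge0 ltW.
  by do 2 apply: mulr_ge0 => //; exact: ltW.
have mwq : measurable_fun [set: V * V] (fun q => (w, q.1, q.2)).
  by apply: measurable_fun_pair => //; apply: measurable_fun_pair.
have mh : measurable_fun setT h.
  apply/measurable_EFinP; apply: measurable_funM.
    apply: measurable_invr; apply: (measurableT_comp (measurable_fun_pair2 w measurable_rho)).
    exact: measurable_fst.
  apply: measurable_funM.
    exact: (measurableT_comp (measurable_indic mA) mwq).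
  apply: measurable_funM.
    exact: (measurableT_comp (measurable_indic mC) (measurableT_comp measurable_uv mwq)).
  exact: (measurableT_comp (measurable_fun_pair2 w mZ)).
have condE u : cond_measure (xi w) [set y - u | y in C]%R [set v | A (w, u, v)] =
    fubini_F lam h u.
  have mAw : measurable [set v | A (w, u, v)].
    rewrite -[X in measurable X]setTI.
    exact: (measurableT_comp mwq (@pair1_measurable _ _ V V u)).
  have mCu : measurable [set y - u | y in C]%R by exact: measurable_translate.
  rewrite /cond_measure rhoE inver gt_eqF// xi_density; last exact: measurableI.
  rewrite integral_mkcond -ge0_integralZr//; last 3 first.
  - apply/(measurable_restrictT _ _).1; first exact: measurableI.
    apply/measurable_EFinP; apply: measurable_funTS.
    exact: (measurable_fun_pair2 w mZ).
  - by move=> v _; apply: erestrict_ge0 => s _; rewrite lee_fin ltW.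
  - by rewrite lee_fin invr_ge0 ltW.
  apply: eq_integral => v _; rewrite epatch_indic indicI -!EFinM; congr (_%:E).
  rewrite image_addr /h/= !indicE.
  rewrite (_ : (v \in [set x | C (x - - u)%R]) = (v + u \in C)%R); last first.
    by apply/idP/idP; rewrite !inE opprK.
  rewrite (_ : (v \in [set v | A (w, u, v)]) = ((w, u, v) \in A)); last first.
    by apply/idP/idP; rewrite !inE.
  by ring.
rewrite (funext condE) ge0_integral_cond_measure//; last 3 first.
- by rewrite C0.
- exact: measurable_fun_fubini_tonelli_F.
- by move=> u; exact: integral_ge0.
apply: eq_integral => u _; rewrite -ge0_integralZr//.
- apply: eq_integral => v _; rewrite -EFinM; congr (_%:E).
  by rewrite /kern /= -/c; ring.
- exact: (measurable_fun_pair2 u mh).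
Qed.

Hypothesis C_stationary :
  eq_distr (randomized_measure P0 xi C)
    (fun '(w, u, v) => (prod_shift thetaW lfmeasure_shift v ((X w, Z w), xi w), v + u)%R)
    (fun '(w, u, v) => (((X w, Z w), xi w), u)).

(** Mass-stationarity over [C] tested against [F], that is [1_A 1_B / z(0)]; the weight [1 / z(0)]
    reproduces the density of [P] with respect to [P0]. *)
Let window_identity (A : set G) (B : set V) :
  measurable A -> measurable B -> B `<=` C ->
  \int[P0]_w \int[lam]_u \int[lam]_v
    (c * \1_C u / rho w u * (\1_A (shift v (Y w)) * \1_B (v + u)))%:E =
  \int[P0]_w (\1_A (Y w) / Z w 0)%:E * (c%:E * lam B).
Proof.
move=> mA mB BC.
pose Y1 (p : Omega * V * V) := (shift p.2 (Y p.1.1), p.2 + p.1.2)%R.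
pose Y2 (p : Omega * V * V) := (Y p.1.1, p.1.2).
pose F (q : G * V) := (\1_A q.1 * \1_B q.2 / q.1.1.2 0)%:E.
have mwv : measurable_fun [set: Omega * V * V] (fun p => (p.1.1, p.2)).
  by apply: measurable_fun_pair => //; exact: measurableT_comp.
have mY1 : measurable_fun setT Y1.
  apply: measurable_fun_pair; last exact: measurable_uv.
  exact: (measurableT_comp measurable_shift_Y mwv).
have mY2 : measurable_fun setT Y2.
  apply: measurable_fun_pair; last exact: measurableT_comp.
  apply: (measurableT_comp measurable_Y); exact: measurableT_comp.
have mF : measurable_fun setT F.
  apply/measurable_EFinP; apply: measurable_funM; first apply: measurable_funM.
  - exact: (measurableT_comp (measurable_indic mA)).
  - exact: (measurableT_comp (measurable_indic mB)).
  - apply: measurable_invr; apply: (measurableT_comp (@measurable_path_ev _ _ H 0%R)).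
    by apply: measurableT_comp => //; exact: measurableT_comp.
have F0 q : 0 <= F q.
  rewrite lee_fin; apply: mulr_ge0; first exact: mulr_ge0.
  by rewrite invr_ge0; apply: paths_ge0; exact: path_valP.
have Y1E : (fun '(w, u, v) =>
    (prod_shift thetaW lfmeasure_shift v ((X w, Z w), xi w), v + u)%R) = Y1.
  by apply/funext => -[[w u] v].
have Y2E : (fun '(w, u, v) => (((X w, Z w), xi w), u)) = Y2.
  by apply/funext => -[[w u] v].
have Y12 D : measurable D -> \int[P0lam2]_(p in Y1 @^-1` D) (kern p)%:E =
                             \int[P0lam2]_(p in Y2 @^-1` D) (kern p)%:E.
  move=> mD; rewrite -!randomized_measureE.
  - by rewrite -Y1E -Y2E; exact: C_stationary.
  - by rewrite -[X in measurable X]setTI; exact: mY2.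
  - by rewrite -[X in measurable X]setTI; exact: mY1.
have := eq_density_pushforward measurable_kern kern_ge0 mY1 mY2 Y12 mF F0.
have mFk Yi : measurable_fun setT Yi ->
    measurable_fun setT (fun p => F (Yi p) * (kern p)%:E).
  move=> mYi; apply: emeasurable_funM; last exact/measurable_EFinP.
  exact: measurableT_comp.
have Fk0 Yi p : 0 <= F (Yi p) * (kern p)%:E.
  by apply: mule_ge0 => //; rewrite lee_fin.
rewrite (integral3 (mFk _ mY1) (Fk0 Y1)) (integral3 (mFk _ mY2) (Fk0 Y2)).
move=> E12; transitivity (\int[P0]_w \int[lam]_u \int[lam]_v
    (F (Y1 (w, u, v)) * (kern (w, u, v))%:E)).
  (* Along [Y1] the weight [1 / z(0)] becomes [1 / Z_v] and cancels the factor [Z_v] of [kern];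
     where [1_B(v + u)] is nonzero, [1_C(v + u)] is 1 because [B] lies in [C]. *)
  apply: eq_integral => w _; apply: eq_integral => u _; apply: eq_integral => v _.
  rewrite -EFinM; congr (_%:E); rewrite /kern /= addr0.
  have [Bvu|Bvu] := boolP ((v + u)%R \in B); last first.
    by rewrite [\1_B _]indicE (negbTE Bvu)/=; ring.
  rewrite [\1_C (v + u)%R]indicE mem_set/=; last by apply: BC; rewrite inE in Bvu.
  by field; rewrite !gt_eqF.
have a0 w : (0 <= \1_A (Y w) / Z w 0)%R.
  apply: mulr_ge0; first by rewrite indicE ler0n.
  by rewrite invr_ge0; exact/ltW/Z_gt0.
rewrite {}E12 -ge0_integralZr//; last 3 first.
- apply/measurable_EFinP; apply: measurable_funM.
    exact: (measurableT_comp (measurable_indic mA)).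
  exact: (measurable_invr (measurable_fun_pair1 (0%R : V) mZ)).
- by move=> w _; rewrite lee_fin.
- by rewrite mule_ge0// lee_fin.
apply: eq_integral => w _.
transitivity (\int[lam]_u ((\1_A (Y w) / Z w 0 * c)%:E * (\1_B u)%:E)).
  apply: eq_integral => u _.
  (* [a] collects the factors free of [v]; what is left integrates to [rho w u], and [1_B 1_C = 1_B]
     since [B] lies in [C]. *)
  pose a : R := (\1_A (Y w) * \1_B u / Z w 0 * (c * \1_C u / rho w u))%R.
  transitivity (\int[lam]_v (a%:E * (\1_C (v + u) * Z w v)%:E)).
    by apply: eq_integral => v _; rewrite -!EFinM /kern /=; congr (_%:E); rewrite /a; ring.
  rewrite ge0_integralZl//; last 3 first.
  - apply/measurable_EFinP; apply: measurable_funM.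
      apply: (measurableT_comp (measurable_indic mC)).
      exact: measurable_addr_rV.
    exact: (measurable_fun_pair2 w mZ).
  - by move=> v _; rewrite lee_fin mulr_ge0// ltW.
  - rewrite lee_fin /a; apply: mulr_ge0.
      by apply: mulr_ge0; [exact: mulr_ge0|rewrite invr_ge0 ltW].
    by apply: mulr_ge0; [exact: mulr_ge0|rewrite invr_ge0 ltW].
  rewrite integral_window -!EFinM /a; congr (_%:E).
  have [Bu|Bu] := boolP (u \in B); last first.
    by rewrite [\1_B _]indicE (negbTE Bu)/=; ring.
  rewrite [\1_C u]indicE mem_set/=; last by apply: BC; rewrite inE in Bu.
  by field; rewrite !gt_eqF.
rewrite ge0_integralZl//; last 2 first.
- by apply/measurable_EFinP; exact: measurable_indic.
- by rewrite lee_fin mulr_ge0.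
by rewrite integral_indic// setIT EFinM muleA.
Qed.

(** [window_identity] is applied to [A] with [B + r], and to the preimage of [A] under [shift r]
    with [B]. The left sides agree after translating [v] by [r]: [rho w u] does not involve [v], and
    [1_{B + r}(v + r + u) = 1_B(v + u)]. *)
Lemma window_shift (A : set G) (B : set V) (r : V) :
  measurable A -> measurable B -> 0 < lam B < +oo ->
  B `<=` C -> [set x + r | x in B]%R `<=` C ->
  \int[P0]_w (\1_A (shift r (Y w)) / Z w 0)%:E =
  \int[P0]_w (\1_A (Y w) / Z w 0)%:E.
Proof.
move=> mA mB /andP[B0 Boo] BC BrC.
have mAr : measurable (shift r @^-1` A).
  by rewrite -[X in measurable X]setTI; exact: measurable_shift.
have mBr : measurable [set x + r | x in B]%R by exact: measurable_translate.
have lamBr : lam [set x + r | x in B]%R = lam B.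
  by rewrite image_addr -[LHS]/(pushforward lam (fun x => x - r)%R B)
    lebesgue_rV_translate.
have E1 := window_identity mAr mB BC.
have := window_identity mA mBr BrC.
rewrite (_ : \int[P0]_w \int[lam]_u \int[lam]_v _ = \int[P0]_w \int[lam]_u
  \int[lam]_v (c * \1_C u / rho w u *
    (\1_(shift r @^-1` A) (shift v (Y w)) * \1_B (v + u)))%:E); last first.
  apply: eq_integral => w _; apply: eq_integral => u _.
  pose g (v : V) := (c * \1_C u / rho w u *
    (\1_A (shift v (Y w)) * \1_([set x + r | x in B]%R) (v + u)))%:E.
  have mg : measurable_fun setT g.
    apply/measurable_EFinP; apply: measurable_funM => //; apply: measurable_funM.
      apply: (measurableT_comp (measurable_indic mA)).
      exact: (measurable_fun_pair2 w measurable_shift_Y).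
    apply: (measurableT_comp (measurable_indic mBr)).
    exact: measurable_addr_rV.
  have g0 v : 0 <= g v.
    rewrite lee_fin; apply: mulr_ge0; last exact: mulr_ge0.
    by apply: mulr_ge0; [exact: mulr_ge0|rewrite invr_ge0 ltW].
  rewrite -[LHS]/(\int[lam]_v g v) -(ge0_integral_translate_rV r mg g0).
  apply: eq_integral => v _; congr (_ * (_ * _))%:E.
    by rewrite !indicE (addrC v) shiftD.
  rewrite image_addr !indicE; congr (nat_of_bool _)%:R.
  by apply/idP/idP; rewrite !inE/= addrAC addrK.
rewrite {}E1 lamBr => /esym E1.
have lamBE : lam B = (fine (lam B))%:E by rewrite fineK// ge0_fin_numE.
have cB : (c * fine (lam B) != 0)%R.
  by rewrite mulf_neq0// ?invr_eq0 gt_eqF// fine_gt0// ?C0 ?B0.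
(* The common factor is positive and finite, so multiplying by its inverse cancels it even when the
   integrals are infinite. *)
have cancel x y : x * (c%:E * lam B) = y * (c%:E * lam B) -> x = y.
  rewrite lamBE -EFinM => xy.
  rewrite -[x]mule1 -[y]mule1 (_ : 1 = (c * fine (lam B))%:E *
    ((c * fine (lam B))^-1)%:E); last by rewrite -EFinM divff.
  by rewrite !muleA xy.
rewrite -(cancel _ _ E1); apply: eq_integral => w _.
by congr (_ / _)%:E.
Qed.

End window.

(** * Stationarity under [P] and the Palm integral *)

Lemma mass_stationary_shift (P0 : {sigma_finite_measure set Omega -> \bar R})
    (A : set G) (r : V) :
  mass_stationary thetaW P0 (fun w => (X w, Z w)) xi -> measurable A ->
  \int[P0]_w (\1_A (shift r (Y w)) / Z w 0)%:E =
  \int[P0]_w (\1_A (Y w) / Z w 0)%:E.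
Proof.
(* With [M = 1 + |r|] the window [cube M] contains both [cube 1] and its translate by [r], since
   coordinates are bounded by the norm. *)
move=> [_ P0_stationary] mA; set M : R := (1 + `|r|)%R.
have M0 : (0 < M)%R by rewrite ltr_pwDl.
have cube_gt0 N : (0 < N)%R -> 0 < lam (@cube R d N).
  by move=> N0; rewrite lebesgue_rV_cube ?ltW// lte_fin exprn_gt0// pmulrn_lgt0.
have cube_lty N : (0 < N)%R -> lam (@cube R d N) < +oo.
  by move=> N0; rewrite lebesgue_rV_cube ?ltW// ltry.
have bM : bounded_set (@cube R d M) by exact/bounded_cube/ltW.
have mM := @measurable_cube R d M.
have statM := P0_stationary _ mM bM (cube_gt0 _ M0) (cube_boundary d M).
have cube1M : @cube R d 1 `<=` cube M.
  move=> x x1 j; have /andP[x1j xj1] := x1 j.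
  have := normr_ge0 r; rewrite /M => r0; apply/andP; split; lra.
have cubeM : [set x + r | x in @cube R d 1]%R `<=` cube M.
  move=> _ [x x1 <-] j; have /andP[x1j xj1] := x1 j.
  have := coord_le_norm r j; rewrite ler_norml => /andP[rj jr].
  by rewrite mxE /M; apply/andP; split; lra.
have cube1 : 0 < lam (@cube R d 1) < +oo by rewrite cube_gt0// cube_lty.
exact: (window_shift mM bM (cube_gt0 _ M0) (cube_lty _ M0) statM mA
  (@measurable_cube R d 1) cube1 cube1M cubeM).
Qed.

Lemma mass_stationary_stationary
    (P0 : {sigma_finite_measure set Omega -> \bar R}) :
  mass_stationary thetaW P0 (fun w => (X w, Z w)) xi ->
  stationary shift (inv_density_measure P0 Z) Y.
Proof.
move=> P0_stationary t A mA.
have PE (f : Omega -> G) : pushforward (inv_density_measure P0 Z) f A =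
    \int[P0]_w (\1_A (f w) / Z w 0)%:E.
  rewrite /pushforward /inv_density_measure integral_mkcond.
  apply: eq_integral => w _; rewrite epatch_indic -EFinM mulrC.
  by rewrite !indicE; congr ((nat_of_bool _)%:R / _)%:E; apply/idP/idP; rewrite !inE.
by rewrite !PE mass_stationary_shift.
Qed.

(** With [xi(dt) = Z_t dt] the inner integrand becomes [h] at [shift t (Y w)], because the shifted
    field has value [Z_t] at 0. After Tonelli's theorem, stationarity makes the [P]-integral
    independent of [t], and integrating over [B] leaves [lam B]. *)
Lemma palm_integral (P : {sigma_finite_measure set Omega -> \bar R})
    (f : G -> \bar R) (B : set V) :
  stationary shift P Y -> measurable_fun setT f -> (forall y, 0 <= f y) ->
  measurable B ->
  \int[P]_w \int[xi w]_(t in B) f (shift t (Y w)) =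
  lam B * \int[P]_w (f (Y w) * (Z w 0)%:E).
Proof.
move=> stP mf f0 mB.
pose h (y : G) := f y * (y.1.2 0)%:E.
have h0 y : 0 <= h y.
  by rewrite mule_ge0// lee_fin; apply: paths_ge0; exact: path_valP.
have mh : measurable_fun setT h.
  apply: emeasurable_funM => //; apply/measurable_EFinP.
  apply: (measurableT_comp (@measurable_path_ev _ _ H 0%R)).
  exact: measurableT_comp.
have mshiftY t : measurable_fun setT (fun w => shift t (Y w)).
  exact: (measurable_fun_pair1 t measurable_shift_Y).
have hstat t : \int[P]_w h (shift t (Y w)) = \int[P]_w h (Y w).
  transitivity (\int[pushforward P (fun w => shift t (Y w))]_y h y).
    by rewrite ge0_integral_pushforward.
  transitivity (\int[pushforward P Y]_y h y).
    by apply: eq_measure_integral => A mA _; exact: stP.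
  by rewrite ge0_integral_pushforward.
pose g (q : Omega * V) := h (shift q.2 (Y q.1)) * (\1_B q.2)%:E.
have mg : measurable_fun setT g.
  apply: emeasurable_funM; first exact: (measurableT_comp mh measurable_shift_Y).
  by apply/measurable_EFinP; exact: (measurableT_comp (measurable_indic mB)).
have g0 q : 0 <= g q by rewrite mule_ge0// lee_fin.
transitivity (\int[P]_w \int[lam]_t g (w, t)).
  apply: eq_integral => w _; rewrite integral_mkcond.
  have mfB : measurable_fun setT ((fun t => f (shift t (Y w))) \_ B).
    have mfw : measurable_fun setT (fun t => f (shift t (Y w))).
      exact: (measurableT_comp mf (measurable_fun_pair2 w measurable_shift_Y)).
    by rewrite -(measurable_restrictT _ mB); exact: measurable_funTS.
  rewrite (ge0_integral_density_field H_meas xi_density Z_gt0 w mfB); last first.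
    by move=> s; apply: erestrict_ge0.
  apply: eq_integral => t _; rewrite epatch_indic /g /h /= addr0.
  by rewrite muleAC.
rewrite fubini_tonelli//.
transitivity (\int[lam]_t (\int[P]_w h (Y w) * (\1_B t)%:E)).
  apply: eq_integral => t _; rewrite -(hstat t) -ge0_integralZr//.
  exact: measurableT_comp.
rewrite ge0_integralZl//.
- by rewrite integral_indic// setIT muleC.
- by apply/measurable_EFinP; exact: measurable_indic.
- exact: integral_ge0.
Qed.

End mass_stationary_density.

(** * Sigma-finiteness under the change of measure *)

Section sigma_finite_pack.
Context d (T : measurableType d) (R : realType).
Variables (mu : {measure set T -> \bar R}) (mu_sf : sigma_finite setT mu).

(** The measure [mu] itself under a name that carries the proof of sigma-finiteness. It is
    convertible to [mu], so hypotheses on [mu] apply as they stand. *)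
Definition sigma_finite_pack of sigma_finite setT mu : set T -> \bar R := mu.

HB.instance Definition _ := Measure.copy (sigma_finite_pack mu_sf) mu.
HB.instance Definition _ :=
  Measure_isSigmaFinite.Build _ _ _ (sigma_finite_pack mu_sf) mu_sf.

End sigma_finite_pack.

(** Where [1 / Z_0] is at most [n + 1], the new mass is at most [n + 1] times the [P0]-mass. [Z0]
    reads [Z_0] off [Y], so that these sets live in [G] and can be cut with an exhausting sequence
    for the law of [Y]. *)
Lemma sigma_finite_inv_density (R : realType) d dO dG
    (Omega : measurableType dO) (G : measurableType dG) (H : pathSpace R d)
    (P0 : {measure set Omega -> \bar R}) (Z : {mfun Omega >-> path_of H})
    (Y : Omega -> G) (Z0 : G -> R) :
  measurable_fun setT Y -> measurable_fun setT Z0 ->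
  (forall w, Z0 (Y w) = Z w 0) -> (forall w, 0 < Z w 0) ->
  sigma_finite setT (pushforward P0 Y) ->
  sigma_finite setT (pushforward (inv_density_measure P0 Z) Y).
Proof.
move=> mY mZ0 Z0E Z_gt0 Y_sf.
have [F [FT ndF Foo]] := (sigma_finiteP setT (pushforward P0 Y)).1 Y_sf.
(* Taking a complement keeps the points with [Z0 y <= 0], which [Y] never reaches, so that the sets
   [D n] cover all of [G]. *)
pose D n := Z0 @^-1` (~` `]0, n.+1%:R^-1[%classic).
have mD n : measurable (D n).
  by rewrite -[X in measurable X]setTI; apply: mZ0 => //; exact: measurableC.
have mFD n : measurable (F n `&` D n) by apply: measurableI => //; exact: (Foo n).1.
exists (fun n => F n `&` D n).
  apply/esym; rewrite -subTset => y _.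
  have [i _ Fi] : (\bigcup_i F i) y by rewrite -FT.
  have [n Dn] : exists n, D n y.
    have [y0|y0] := leP (Z0 y) 0.
      by exists 0%N; rewrite /D/= in_itv/= ltNge y0.
    exists (Num.truncn (Z0 y)^-1); rewrite /D/= in_itv/= y0/=; apply/negP.
    rewrite -leNgt invf_ple ?posrE ?ltr0n//; exact/ltW/truncnS_gt.
  exists (maxn i n) => //; split.
    by move: Fi; exact/subsetPset/ndF/leq_maxl.
  move: Dn; rewrite /D/= !in_itv/=; apply: contra_not => /andP[-> /=] /lt_le_trans.
  by apply; rewrite lef_pV2 ?posrE ?ltr0n// ler_nat ltnS leq_maxr.
move=> n; split => //; have [mF Fn] := Foo n.
have mA : measurable (Y @^-1` (F n `&` D n)).
  by rewrite -[X in measurable X]setTI; exact: (mY measurableT _ (mFD n)).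
have mYF : measurable (Y @^-1` F n).
  by rewrite -[X in measurable X]setTI; exact: (mY measurableT _ mF).
apply: (@le_lt_trans _ _ (n.+1%:R%:E * pushforward P0 Y (F n))%E); last first.
  by rewrite lte_mul_pinfty// lee_fin.
apply: (@le_trans _ _ (\int[P0]_(w in Y @^-1` (F n `&` D n)) n.+1%:R%:E)%E).
  apply: ge0_le_integral => //.
  - by move=> w _; rewrite lee_fin invr_ge0 ltW.
  - apply/measurable_EFinP/measurable_funTS/measurable_invr.
    exact: (measurableT_comp (@measurable_path_ev _ _ H 0%R) (measurable_funPT Z)).
  - move=> w [_]; rewrite /D/= in_itv/= Z0E Z_gt0/= => /negP.
    by rewrite -leNgt lee_fin => nZ; rewrite invf_ple ?posrE ?ltr0n.
rewrite integral_cst// lee_wpmul2l// ?lee_fin// le_measure ?inE//.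
by move=> w [].
Qed.

(** * Stationarity under [P] and the return to [P0] by the Palm formula *)

Theorem theorem5 (R : realType) (d : nat)
    (dO dE : measure_display)
    (Omega : measurableType dO) (E : measurableType dE)
    (thetaE : 'rV[R]_d -> E -> E)
    (thetaE_action : is_action thetaE)
    (thetaE_meas : shift_measurable thetaE)
    (H : pathSpace R d)
    (H_meas : shift_measurable (@path_shift R d H))
    (X : {mfun Omega >-> E})
    (Z : {mfun Omega >-> path_of H})
    (xi : {mfun Omega >-> lfmeasure R d})
    (P0 : {measure set Omega -> \bar R})
    (P0_sigma_finite :
      sigma_finite [set: E * path_of H * lfmeasure R d]
        (pushforward P0 (fun w => ((X w, Z w), xi w))))
    (xi_density : has_density_field xi Z)
    (Z_gt0 : forall w s, 0 < Z w s)
    (xi_mass_stationary :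
      mass_stationary (prod_shift thetaE (@path_shift R d H)) P0
        (fun w => (X w, Z w)) xi) :
  let P := inv_density_measure P0 Z in
  sigma_finite [set: E * path_of H * lfmeasure R d]
    (pushforward P (fun w => ((X w, Z w), xi w))) /\
  stationary (prod_shift thetaE (@path_shift R d H)) P
    (fun w => (X w, Z w)) /\
  palm_version (prod_shift thetaE (@path_shift R d H)) P0 P
    (fun w => (X w, Z w)) xi.
Proof.
pose Y w := ((X w, Z w), xi w).
have mY : measurable_fun setT Y.
  apply: measurable_fun_pair; first apply: measurable_fun_pair.
  - exact: (@measurable_funPT _ _ _ _ X).
  - exact: (@measurable_funPT _ _ _ _ Z).
  - exact: (@measurable_funPT _ _ _ _ xi).
have P0_sf := sigma_finite_pushforward mY P0_sigma_finite.
pose P0s := sigma_finite_pack P0_sf.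
have st : stationary (prod_shift (prod_shift thetaE (@path_shift R d H)) lfmeasure_shift)
   (inv_density_measure P0 Z) Y.
  exact: (mass_stationary_stationary thetaE_action thetaE_meas H_meas xi_density Z_gt0
    (xi_mass_stationary : mass_stationary _ P0s _ _)).
pose P := inv_density_measure P0 Z.
have P_pushforward_sf : sigma_finite setT (pushforward P Y).
  pose Z0 (y : E * path_of H * lfmeasure R d) : R := y.1.2 0.
  have mZ0 : measurable_fun setT Z0.
    apply: (measurableT_comp (@measurable_path_ev _ _ H 0%R)).
    exact: measurableT_comp.
  exact: (sigma_finite_inv_density mY mZ0 (fun=> erefl) (fun w => Z_gt0 w 0)
    P0_sigma_finite).
pose Ps := sigma_finite_pack (sigma_finite_pushforward mY P_pushforward_sf).
split; [exact: P_pushforward_sf|split].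
  (* Stationarity of [(X, Z)] is joint stationarity tested on cylinders, [A] times the whole space
     of measures. *)
  move=> t A mA; have := st t (A `*` setT) (measurableX mA measurableT).
  have AE (f : Omega -> E * path_of H) (g : Omega -> lfmeasure R d) :
      (fun w => (f w, g w)) @^-1` (A `*` setT) = f @^-1` A.
    by apply/seteqP; split => w /= => [[]|].
  by rewrite /pushforward !AE.
split; first exact: st.
move=> f mf f0 B mB /andP[B0 Boo].
rewrite -[X in (X / _)%E]/(\int[Ps]_w \int[xi w]_(t in B) f (prod_shift (prod_shift thetaE
  (@path_shift R d H)) lfmeasure_shift t (Y w)))%E.
rewrite (palm_integral thetaE_meas H_meas xi_density Z_gt0)//.
rewrite muleAC divee ?gt_eqF ?ge0_fin_numE// mul1e.
have mZ0 : measurable_fun setT (fun w => Z w 0).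
  exact: (measurableT_comp (@measurable_path_ev _ _ H 0%R) (measurable_funPT Z)).
(* [P] has density [1 / Z_0] with respect to [P0], which cancels the factor [Z_0] of the Palm
   integral. *)
rewrite (@ge0_integral_density _ _ _ P0 Ps (fun w => (Z w 0)^-1)).
- apply: eq_integral => w _; rewrite -muleA -EFinM divff ?mule1//.
  by rewrite gt_eqF.
- exact: measurable_invr.
- by move=> w; rewrite invr_ge0 ltW.
- by [].
- apply: emeasurable_funM; first exact: (measurableT_comp mf mY).
  exact/measurable_EFinP.
- by move=> w; apply: mule_ge0 => //; rewrite lee_fin ltW.
Qed.
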